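(* Set $\eta=a_\infty$, and let $\ell_i^{(1)}(\eta)$ and $\ell_i^{(2)}(\eta)$ be the complexity expressions defined in the context. Let $\delta>0$ and $\epsilon>0$; $e$ denotes the base of the natural logarithm. (a) Let $n_0=\lceil B_2/B_1\rceil$ and $n'=B_1(1+n_0)$. With $D=\frac{n'+2(n')^2\delta^{-1}}{e\ln(\eta^{-1})}$ (and the corresponding $q$, see context) and $\hat\epsilon=\frac{\epsilon}{C+D}\,\eta^{\frac{B_1-1}{B_1(n_0+1)}}$, $$\ell_i^{(1)}(\eta)\le\frac{Q_i}{\eta^4\ln(1/\eta^2)}\left(\frac1{\hat\epsilon}\right)^{2n'+\delta}+\left\lceil\ln\left(\frac1{\hat\epsilon}\right)\frac{2n'+\delta}{2\ln(\eta^{-1})}\right\rceil .$$ In particular, if $B_1=1$, then with $D=\frac{(1+B_2)+2(1+B_2)^2\delta^{-1}}{e\ln(\eta^{-1})}$, $$\ell_i^{(1)}(\eta)\le\frac{Q_i}{\eta^4\ln(1/\eta^2)}\left(\frac{C+D}{\epsilon}\right)^{2(1+B_2)+\delta}+\left\lceil\ln\left(\frac{C+D}{\epsilon}\right)\frac{2(B_2+1)+\delta}{2\ln(\eta^{-1})}\right\rceil ,$$ and if $B_1=1$, $B_2=0$, then with $D=\frac{1+2\delta^{-1}}{e\ln(\eta^{-1})}$, $$\ell_i^{(1)}(\eta)\le\frac{Q_i}{\eta^4\ln(1/\eta^2)}\left(\frac{C+D}{\epsilon}\right)^{2+\delta}+\left\lceil\ln\left(\frac{C+D}{\epsilon}\right)\frac{2+\delta}{2\ln(\eta^{-1})}\right\rceil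 .$$ (b) Let $n_0=\lceil B_2/N\rceil$. With $D=N(1+n_0)\frac{1+2(1+n_0)\delta^{-1}}{e\ln(\eta^{-1})}$ (and the corresponding $q$, see context) and $\tilde\epsilon=\frac{\epsilon}{C+D}\,\eta^{\frac{N-1}{N(1+n_0)}}$, $$\ell_i^{(2)}(\eta)\le\frac{Q_i}{\eta^{2+\frac2N}\ln(1/\eta^{\frac2N})}\left(\frac1{\tilde\epsilon}\right)^{2(n_0+1)+\delta}+\left\lceil\ln\left(\frac1{\tilde\epsilon}\right)\frac{2(n_0+1)+\delta}{2\ln(\eta^{-1})/N}\right\rceil .$$ In particular, if $B_2=0$, then with $D=\frac{N(1+2\delta^{-1})}{e\ln(\eta^{-1})}$ and $\tilde\epsilon=\frac{\epsilon}{C+D}\,\eta^{\frac{N-1}{N}}$, $$\ell_i^{(2)}(\eta)\le\frac{Q_i}{\eta^{2+\frac2N}\ln(1/\eta^{\frac2N})}\left(\frac1{\tilde\epsilon}\right)^{2+\delta}+\left\lceil\ln\left(\frac1{\tilde\epsilon}\right)\frac{(2+\delta)N}{2\ln(\eta^{-1})}\right\rceil .$$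
   Context: Setting. In an $N$-player stochastic Nash game, player $i$ minimizes $f_i(x_i,x_{-i})=\mathbb E[\psi_i(x_i,x_{-i};\xi)]$ over a compact convex set $X_i\subseteq\mathbb R^{n_i}$ of diameter $D_{X_i}$; $X=\prod_iX_i$; each $f_i(\cdot,x_{-i})$ is convex and $f_i$ is twice differentiable; $\mathbb E[\|\nabla_{x_i}\psi_i(x;\xi)\|^2]\le M_i^2$ on $X$ with $M_i>0$. For fixed $\mu>0$ put $\zeta_{i,\min}=\inf_{x\in X}\lambda_{\min}(\nabla^2_{x_i}f_i(x))$, $\zeta_{ij,\max}=\sup_{x\in X}\|\nabla^2_{x_ix_j}f_i(x)\|$ ($j\ne i$), and let $\Gamma\in\mathbb R^{N\times N}$ have entries $\Gamma_{ii}=\frac{\mu}{\mu+\zeta_{i,\min}}$, $\Gamma_{ij}=\frac{\zeta_{ij,\max}}{\mu+\zeta_{i,\min}}$ ($j\neq i$). It is assumed that $\zeta_{i,\min}>\sum_{j\ne i}\zeta_{ij,\max}$ for all $i$, so that $a_\infty:=\|\Gamma\|_\infty\in(0,1)$ (maximum row sum). Put $Q_i=\frac{2M_i^2}{\mu^2}+2D_{X_i}^2>0$. $C\ge0$ is a bound on the expected initial error, $\max_i\mathbb E[\|x_{i,0}-x_i^*\|^2]\le C^2$ with $x^*$ the Nash equilibrium; $B_1\ge1$ is an integer such that each player updates at least once in any time interval of length $B_1$; $B_2\ge0$ is an integer bounding the communication delays. Complexity expressions (for $\eta\in(0,1)$, $\epsilon>0$). They are upper bounds on the number of projected stochastic gradient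 steps that player $i$ needs in an asynchronous inexact proximal best-response scheme (inexactness $\alpha_{i,k}=\eta^{\beta_{i,k}}$, with $\beta_{i,k}$ the number of updates of player $i$ up to and including iteration $k$, inexact solutions by stochastic approximation) to reach a random profile $x$ with $\max_i\mathbb E\|x_i-x_i^*\|\le\epsilon$; $\ell^{(1)}_i$ is for general updates and $\ell^{(2)}_i$ for cyclic updates (one player per iteration in cyclic order). (1) With $n_0=\lceil B_2/B_1\rceil$, $\rho=(\max\{a_\infty,\eta\})^{1/(n_0+1)}$, $c=\rho^{1/B_1}$, $q\in(c,1)$, $D=1/\ln\big((q/c)^e\big)$, $\hat\epsilon=\frac{\epsilon}{C+D}\rho^{\frac{B_1-1}{B_1}}$: $$\ell_i^{(1)}(\eta)=\frac{Q_i}{\eta^4\ln(1/\eta^2)}\left(\frac1{\hat\epsilon}\right)^{\frac{\ln(1/\eta^2)}{\ln(1/q)}}+\left\lceil\frac{\ln(1/\hat\epsilon)}{\ln(1/q)}\right\rceil .$$ (2) With $n_0=\lceil B_2/N\rceil$, $\rho=(\max\{a_\infty,\eta\})^{1/(n_0+1)}$, $c=\rho^{1/N}$, $q\in(c,1)$, $D=1/\ln\big((q/c)^e\big)$, $\tilde\epsilon=\frac{\epsilon}{C+D}\rho^{\frac{N-1}{N}}$, $\tilde\eta=\eta^{1/N}$: $$\ell_i^{(2)}(\eta)=\frac{Q_i}{\tilde\eta^2\eta^2\ln(1/\tilde\eta^2)}\left(\frac1{\tilde\epsilon}\right)^{\frac{\ln(1/\tilde\eta^2)}{\ln(1/q)}}+\left\lceil\frac{\ln(1/\tilde\epsilon)}{\ln(1/q)}\right\rceil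 .$$ In each case of the claim, $q$ is the parameter in $(c,1)$ determined by the prescribed value of $D$ through $D=1/\ln\big((q/c)^e\big)$. *)

(* Defs.v *)
From HB Require Import structures.
From mathcomp Require Import all_boot all_order all_fingroup all_algebra.
From mathcomp Require Import all_classical all_reals all_analysis.

Set Implicit Arguments.
Unset Strict Implicit.
Unset Printing Implicit Defensive.

Import Order.TTheory GRing.Theory Num.Theory.
Import numFieldNormedType.Exports.

Local Open Scope classical_set_scope.
Local Open Scope ring_scope.

Section euclidean.
Context {R : realType}.

(* Used on row and column vectors. The library norm `|v| on matrices is the
   sup norm; it induces the same topology and the same derivatives, but not
   the same diameters, moments and operator norms. *)
Definition enorm m n (v : 'M[R]_(m, n)) : R :=
  Num.sqrt (\sum_i \sum_j v i j ^+ 2).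

Definition ediam n (A : set 'rV[R]_n) : R :=
  sup [set enorm (p.1 - p.2) | p in A `*` A].

(* the operator norm induced by the Euclidean norms *)
Definition opnorm m n (A : 'M[R]_(m, n)) : R :=
  sup [set enorm (A *m v) | v in [set v : 'cV[R]_n | enorm v <= 1]].

(* For a symmetric matrix of positive size this is the least eigenvalue. *)
Definition lambda_min n (A : 'M[R]_n) : R := inf [set a | eigenvalue A a].

(* the maximum absolute row sum *)
Definition norm_infty n (A : 'M[R]_n) : R :=
  \big[Num.max/0]_(i < n) \sum_(j < n) `|A i j|.

Definition grad n (f : 'rV[R]_n -> R) (x : 'rV[R]_n) : 'rV[R]_n :=
  \row_k 'D_(delta_mx 0 k) f x.

Definition hessian n (f : 'rV[R]_n -> R) (x : 'rV[R]_n) : 'M[R]_n :=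
  'J (grad f) x.

Definition twice_differentiable n (f : 'rV[R]_n -> R) (x : 'rV[R]_n) : Prop :=
  (\forall y \near x, differentiable f y) /\ differentiable (grad f) x.

End euclidean.

(* A strategy profile (x_1, ..., x_N) is the concatenated row vector of
   R^(n_1 + ... + n_N); x_i is [submxrow x i], and the (i, j) block of a
   Hessian is [submxblock H i j]. *)
Record stoch_game (R : realType) (N : nat) := StochGame {
  dim : 'I_N -> nat ;
  strat : forall i, set 'rV[R]_(dim i) ;
  dispO : measure_display ;
  Omega : measurableType dispO ;
  prob : probability Omega R ;
  dispX : measure_display ;
  Xi : measurableType dispX ;
  xi : {mfun Omega >-> Xi} ;
  psi : 'I_N -> 'rV[R]_(\sum_i dim i) -> Xi -> R }.
Arguments strat {R N} s i : rename.
Arguments prob {R N} s : rename.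
Arguments xi {R N} s : rename.
Arguments psi {R N} s i x t : rename.

Section game.
Context {R : realType} {N : nat} (G : stoch_game R N).

Definition profile := 'rV[R]_(\sum_i dim G i).

Definition feasible : set profile :=
  [set x | forall i, strat G i (submxrow x i)].

(* the profile (y, x_{-i}) *)
Definition deviate (x : profile) (i : 'I_N) (y : 'rV[R]_(dim G i)) : profile :=
  \mxrow_j dfwith (fun k => submxrow x k) i y j.
Arguments deviate x i y : clear implicits.

Definition payoff (i : 'I_N) (x : profile) : R :=
  fine ('E_(prob G)[fun w => psi G i x (xi G w)])%E.

Definition grad_psi (i : 'I_N) (x : profile) (s : Xi G) : 'rV[R]_(dim G i) :=
  grad (fun y => psi G i (deviate x i y) s) (submxrow x i).

(* Integrability near each feasible point makes [payoff] a genuine expectation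
   where it is differentiated. *)
Record standing_assumptions (M : 'I_N -> R) : Prop := StandingAssumptions {
  strat_compact : forall i, compact (strat G i) ;
  strat_convex : forall i,
    convex_set (strat G i : set (convex_lmodType 'rV[R]_(dim G i))) ;
  psi_integrable : forall i x, feasible x -> \forall y \near x,
    (prob G).-integrable setT (EFin \o (fun w => psi G i y (xi G w))) ;
  payoff_convex : forall i x, feasible x ->
    convex_function (strat G i : set (convex_lmodType 'rV[R]_(dim G i)))
      (fun y => payoff i (deviate x i y)) ;
  payoff_twice_differentiable : forall i x, feasible x ->
    twice_differentiable (payoff i) x ;
  psi_differentiable : forall i x (s : Xi G), feasible x ->
    differentiable (fun y => psi G i (deviate x i y) s) (submxrow x i) ;
  M_gt0 : forall i, 0 < M i ;
  grad_psi_bound : forall i x, feasible x ->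
    ('E_(prob G)[fun w => (enorm (grad_psi i x (xi G w)) ^+ 2)%R]
       <= (M i ^+ 2)%:E)%E }.

Definition nash_equilibrium (x : profile) : Prop :=
  feasible x /\
  forall i (y : 'rV[R]_(dim G i)), strat G i y ->
    payoff i x <= payoff i (deviate x i y).

Definition zeta_min (i : 'I_N) : \bar R :=
  ereal_inf [set (lambda_min (submxblock (hessian (payoff i) x) i i))%:E
            | x in feasible].

Definition zeta_max (i j : 'I_N) : \bar R :=
  ereal_sup [set (opnorm (submxblock (hessian (payoff i) x) i j))%:E
            | x in feasible].

(* As [zeta_max i j >= 0] and [zeta_min i < +oo] when there is a feasible
   profile, this makes all the quantities involved finite, so that the uses
   of [fine] in [Gamma] are harmless. It also excludes [dim G i = 0]. *)
Definition diagonal_dominance : Prop :=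
  forall i, (\sum_(j < N | j != i) zeta_max i j < zeta_min i)%E.

Definition Gamma (mu : R) : 'M[R]_N :=
  \matrix_(i, j)
    if j == i then mu / (mu + fine (zeta_min i))
    else fine (zeta_max i j) / (mu + fine (zeta_min i)).

Definition a_infty (mu : R) : R := norm_infty (Gamma mu).

Definition Qconst (M : 'I_N -> R) (mu : R) (i : 'I_N) : R :=
  2 * M i ^+ 2 / mu ^+ 2 + 2 * ediam (strat G i) ^+ 2.

Definition initial_error_bound (xstar : profile) (x0 : Omega G -> profile)
    (C : R) : Prop :=
  (forall k, measurable_fun setT (fun w => x0 w 0 k)) /\
  forall i, ('E_(prob G)[fun w => (enorm (submxrow (x0 w - xstar)%R i) ^+ 2)%R]
               <= (C ^+ 2)%:E)%E.

End game.

(* [U k] is the set of players updating at iteration k, and [tau i j k] is the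
   age of player j's strategy as known to player i at iteration k. *)
Section schedule.
Context {N : nat}.

Definition updates_within (U : nat -> {set 'I_N}) (B1 : nat) : Prop :=
  forall i k, exists2 t, (k <= t < k + B1)%N & i \in U t.

Definition cyclic_updates (U : nat -> {set 'I_N}) : Prop :=
  exists s : 'S_N, forall k i, (i \in U k) = (val (s i) == k %% N)%N.

Definition delays_within (tau : 'I_N -> 'I_N -> nat -> nat) (B2 : nat) : Prop :=
  forall i j k, (tau i j k <= B2)%N.

End schedule.

(* The constants common to both complexity expressions; the period p is B1 for
   general updates and N for cyclic updates. *)
Section complexity.
Context {R : realType}.

Definition delay_periods (p B2 : nat) : R :=
  (Num.ceil (B2%:R / p%:R : R))%:~R.

Definition rho (a : R) (p B2 : nat) (eta : R) : R :=
  (Num.max a eta) `^ (delay_periods p B2 + 1)^-1.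

Definition cpar (a : R) (p B2 : nat) (eta : R) : R :=
  (rho a p B2 eta) `^ (p%:R^-1).

Definition Dpar (c q : R) : R := (ln ((q / c) `^ expR 1))^-1.

Definition qpar (c D q : R) : Prop := c < q < 1 /\ D = Dpar c q.

Definition scaled_eps (a C eps : R) (p B2 : nat) (q eta : R) : R :=
  eps / (C + Dpar (cpar a p B2 eta) q)
    * (rho a p B2 eta) `^ ((p%:R - 1) / p%:R).

Definition ell1 (a Q C eps : R) (B1 B2 : nat) (q eta : R) : R :=
  let epsh := scaled_eps a C eps B1 B2 q eta in
  Q / (eta ^+ 4 * ln (1 / eta ^+ 2))
    * (1 / epsh) `^ (ln (1 / eta ^+ 2) / ln (1 / q))
  + (Num.ceil (ln (1 / epsh) / ln (1 / q)))%:~R.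

Definition ell2 (a Q C eps : R) (N B2 : nat) (q eta : R) : R :=
  let epst := scaled_eps a C eps N B2 q eta in
  let etat := eta `^ (N%:R^-1) in
  Q / (etat ^+ 2 * eta ^+ 2 * ln (1 / etat ^+ 2))
    * (1 / epst) `^ (ln (1 / etat ^+ 2) / ln (1 / q))
  + (Num.ceil (ln (1 / epst) / ln (1 / q)))%:~R.

End complexity.

(* Main.v *)
(* Write eta = a_infty, L = ln (1/eta), m = 1 + n_0, and let p be B1 or N.
   Diagonal dominance forces every zeta to be finite, and then each row of Gamma
   has a sum strictly between 0 and 1, so that 0 < eta < 1. As c = eta^(1/(pm)),
   inverting D = 1/(e ln (q/c)) gives ln q = - L/(pm) + 1/(e D). For the
   prescribed D = pm (1 + 2s/delta)/(e L) this reads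
   ln (1/q) = 2sL/(pm (2s + delta)), which is positive, hence q < 1, and which
   turns the asserted bounds into equalities. *)
Require Import Defs.
From HB Require Import structures.
From mathcomp Require Import all_boot all_order all_algebra.
From mathcomp Require Import all_classical all_reals all_analysis.
From mathcomp Require Import ring.

Set Implicit Arguments.
Unset Strict Implicit.
Unset Printing Implicit Defensive.

Import Order.TTheory GRing.Theory Num.Theory.
Import numFieldNormedType.Exports.

Local Open Scope classical_set_scope.
Local Open Scope ring_scope.

(** * The curvature bounds and the contraction modulus *)

Lemma opnorm_ge0 (R : realType) m n (A : 'M[R]_(m, n)) : 0 <= opnorm A.
Proof.
rewrite /opnorm; set E := (X in sup X).
(* By convention [sup] is 0 on a set without supremum, so boundedness of [E] need not be shown. *)
have [supE|/sup_out -> //] := pselect (has_sup E).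
have [[x Ex] ubE] := supE.
apply: (@le_trans _ _ x); last exact: ub_le_sup.
by case: Ex => v _ <-; exact: sqrtr_ge0.
Qed.

Section contraction_modulus.
Context {R : realType} {N : nat} {G : stoch_game R N}.
Hypothesis G_feasible : exists x : profile G, feasible x.
Hypothesis G_dom : diagonal_dominance G.

Lemma zeta_max_ge0 (i j : 'I_N) : (0 <= zeta_max G i j)%E.
Proof.
have [x Fx] := G_feasible.
have : ((opnorm (submxblock (hessian (payoff i) x) i j))%:E <= zeta_max G i j)%E.
  by apply: ereal_sup_ubound; exists x.
by apply: le_trans; rewrite lee_fin opnorm_ge0.
Qed.

Lemma zeta_min_lty (i : 'I_N) : (zeta_min G i < +oo)%E.
Proof.
have [x Fx] := G_feasible.
have : (zeta_min G i <=
    (lambda_min (submxblock (hessian (payoff i) x) i i))%:E)%E.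
  by apply: ereal_inf_lbound; exists x.
by move=> /le_lt_trans; apply; exact: ltry.
Qed.

(** Dominance puts the off-diagonal sum strictly below [zeta_min G i < +oo]; a finite sum of
    nonnegative terms has finite terms. *)
Lemma zeta_max_fin_num (i j : 'I_N) : j != i -> zeta_max G i j \is a fin_num.
Proof.
move=> ji; have: (\sum_(k < N | k != i) zeta_max G i k)%E \is a fin_num.
  rewrite ge0_fin_numE; first exact: lt_trans (G_dom i) (zeta_min_lty i).
  by apply: sume_ge0 => k _; exact: zeta_max_ge0.
by move=> /sum_fin_numP; apply; rewrite // mem_index_enum.
Qed.

Lemma fine_diagonal_dominance (i : 'I_N) :
  \sum_(j < N | j != i) fine (zeta_max G i j) < fine (zeta_min G i).
Proof.
have := G_dom i; rewrite -EFin_sum_fine; last first.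
  by move=> j; exact: zeta_max_fin_num.
(* Only a real [zeta_min G i] survives: +oo is excluded by [zeta_min_lty], and no real lies below
   -oo. *)
by have := zeta_min_lty i; case: (zeta_min G i).
Qed.

Lemma a_infty_itv (mu : R) : (0 < N)%N -> 0 < mu -> 0 < a_infty G mu < 1.
Proof.
move=> N0 mu0.
pose S i := \sum_(j < N | j != i) fine (zeta_max G i j).
have S0 i : 0 <= S i.
  by apply: sumr_ge0 => j _; exact/fine_ge0/zeta_max_ge0.
have den0 i : 0 < mu + fine (zeta_min G i).
  by rewrite addr_gt0// (le_lt_trans (S0 i)) ?fine_diagonal_dominance.
have row i : \sum_(j < N) `|Gamma G mu i j| =
    (mu + S i) / (mu + fine (zeta_min G i)).
  rewrite (bigD1 i)//= mxE eqxx ger0_norm ?divr_ge0 ?ltW// mulrDl; congr +%R.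
  rewrite mulr_suml; apply: eq_bigr => j ji; rewrite mxE (negPf ji) ger0_norm//.
  by rewrite divr_ge0 ?fine_ge0 ?zeta_max_ge0 ?ltW.
rewrite /a_infty /norm_infty; apply/andP; split.
  (* A maximum over no rows would be 0, so positivity is read off an actual row, the one of index
     0. *)
  apply: lt_le_trans (le_bigmax _ _ (Ordinal N0)).
  by rewrite row divr_gt0// ltr_pwDl.
apply: bigmax_lt => // i _.
by rewrite row ltr_pdivrMr// mul1r ltrD2l fine_diagonal_dominance.
Qed.

End contraction_modulus.

(** * The parameter q determined by the prescribed D *)

Section rate.
Context {R : realType}.
Implicit Types c D q eta p m s delta : R.

(** For positive q the equation for D reads [D = 1 / (e (ln q - ln c))], which can be solved for
    [ln q]. Then [0 < D] gives [c < q], and the sign hypothesis gives [q < 1]. *)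
Lemma qpar_unique c D : 0 < c -> 0 < D -> ln c + (expR 1 * D)^-1 < 0 ->
  unique (qpar c D) (expR (ln c + (expR 1 * D)^-1)).
Proof.
move=> c0 D0 neg.
have e0 : 0 < expR 1 :> R by exact: expR_gt0.
have lnDpar q : 0 < q -> Dpar c q = (expR 1 * (ln q - ln c))^-1.
  by move=> q0; rewrite /Dpar ln_powR ln_div.
split.
  rewrite /qpar expR_lt1 neg andbT; split.
    by rewrite -[ltLHS](lnK c0) ltr_expR ltrDl invr_gt0 mulr_gt0.
  rewrite lnDpar ?expR_gt0// expRK addrAC subrr add0r; field.
  by rewrite !gt_eqF.
move=> q [/andP[cq _]]; have q0 := lt_trans c0 cq.
rewrite lnDpar// => ->.
by rewrite [(_ * _^-1)^-1]invfM invrK mulKf ?gt_eqF// addrC subrK lnK.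
Qed.

(* Part (a) of the theorem uses s = pm, part (b) uses s = m. *)
Lemma prescribed_rate eta p m s delta D :
  0 < eta < 1 -> 0 < p -> 0 < m -> 0 < s -> 0 < delta ->
  D = p * m * (1 + 2 * s / delta) / (expR 1 * ln eta^-1) ->
  exists2 q, unique (qpar ((eta `^ m^-1) `^ p^-1) D) q &
    ln (1 / q) = 2 * s * ln eta^-1 / (p * m * (2 * s + delta)).
Proof.
move=> /andP[eta0 eta1] p0 m0 s0 d0 ->.
have e0 : 0 < expR 1 :> R by exact: expR_gt0.
have L0 : 0 < ln eta^-1 by rewrite ln_gt0// invf_gt1.
have lnc : ln ((eta `^ m^-1) `^ p^-1) = - (ln eta^-1 / (p * m)).
  rewrite !ln_powR lnV// mulNr opprK; field.
  by rewrite !gt_eqF.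
have s2d : 0 < 2 * s + delta by rewrite addr_gt0 ?mulr_gt0.
set D' := p * m * _ / _.
have D0 : 0 < D'.
  by rewrite /D' !(mulr_gt0, invr_gt0, addr_gt0).
(* The factor e cancels and [1 / (e D')] is the fraction [delta / (2 s + delta)] of [- ln c], so the
   fraction [2 s / (2 s + delta)] of [ln c] remains. *)
have lnq : ln ((eta `^ m^-1) `^ p^-1) + (expR 1 * D')^-1 =
    - (2 * s * ln eta^-1 / (p * m * (2 * s + delta))).
  rewrite lnc /D'; field.
  by rewrite !gt_eqF.
exists (expR (ln ((eta `^ m^-1) `^ p^-1) + (expR 1 * D')^-1)).
  apply: qpar_unique => //; first by rewrite !powR_gt0.
  by rewrite lnq oppr_lt0 !(mulr_gt0, invr_gt0).
by rewrite div1r -expRN expRK lnq opprK.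
Qed.

(** * The complexity expressions evaluated at this q *)

Lemma rhoE eta (p B2 : nat) : rho eta p B2 eta = eta `^ (1 + delay_periods p B2)^-1.
Proof. by rewrite /rho maxxx addrC. Qed.

Lemma delay_periods_ge0 (p B2 : nat) : 0 <= delay_periods p B2 :> R.
Proof.
by rewrite /delay_periods ler0z ceil_ge0 (lt_le_trans (ltrN10 _))// divr_ge0.
Qed.

Lemma delay_periods1 (B2 : nat) : delay_periods 1 B2 = B2%:R :> R.
Proof. by rewrite /delay_periods divr1 pmulrn intrKceil. Qed.

Lemma delay_periods0 (p : nat) : delay_periods p 0 = 0 :> R.
Proof. by rewrite /delay_periods mul0r ceil0. Qed.

Lemma scaled_epsE eta C eps D q (p B2 : nat) :
  D = Dpar (cpar eta p B2 eta) q ->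
  scaled_eps eta C eps p B2 q eta =
  eps / (C + D) * eta `^ ((p%:R - 1) / (p%:R * (delay_periods p B2 + 1))).
Proof.
move=> ->; rewrite /scaled_eps rhoE -powRrM; congr (_ * _ `^ _).
by rewrite [1 + _]addrC invfM [RHS]mulrA [RHS]mulrC.
Qed.

(** Taking [s = n' = p m] cancels the factor [p m] in the rate, so
    [ln (1/q) = 2 L / (2 n' + delta)]. Dividing [ln (1/eta^2) = 2 L] by it leaves the exponent
    [2 n' + delta]. *)
Lemma ell1_prescribed eta Q C eps delta (p B2 : nat) :
  0 < eta < 1 -> 0 < delta -> (0 < p)%N ->
  let n0 := delay_periods p B2 in
  let n' := p%:R * (1 + n0) in
  let D := (n' + 2 * n' ^+ 2 * delta^-1) / (expR 1 * ln eta^-1) in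
  let epsh := eps / (C + D) * eta `^ ((p%:R - 1) / (p%:R * (n0 + 1))) in
  exists2 q, unique (qpar (cpar eta p B2 eta) D) q &
    ell1 eta Q C eps p B2 q eta =
      Q / (eta ^+ 4 * ln (1 / eta ^+ 2)) * (1 / epsh) `^ (2 * n' + delta)
      + (Num.ceil (ln (1 / epsh) * ((2 * n' + delta) / (2 * ln eta^-1))))%:~R.
Proof.
move=> eta01 d0 p_gt0 n0 n' D epsh; have /andP[eta0 eta1] := eta01.
have p0 : 0 < p%:R :> R by rewrite ltr0n.
have m0 : 0 < 1 + n0 by rewrite ltr_pwDl ?delay_periods_ge0.
have n'0 : 0 < n' by rewrite mulr_gt0.
have L0 : 0 < ln eta^-1 by rewrite ln_gt0// invf_gt1.
have [|q uq lnq] := @prescribed_rate eta p%:R (1 + n0) n' delta D eta01 p0 m0 n'0 d0.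
  (* The numerator of D factors as [n' (1 + 2 n' / delta)], the form required for [s = n']. *)
  by rewrite /D; congr (_ / _); rewrite -/n' mulrDr mulr1 expr2; ring.
exists q; first by rewrite /cpar rhoE.
have DE : D = Dpar (cpar eta p B2 eta) q by case: uq => -[_]; rewrite /cpar rhoE.
have s2d : 0 < 2 * n' + delta by rewrite addr_gt0 ?mulr_gt0.
have {}lnq : ln (1 / q) = 2 * ln eta^-1 / (2 * n' + delta).
  by rewrite lnq -/n'; field; rewrite !gt_eqF.
rewrite /ell1 (scaled_epsE _ _ DE) -/n0 -/epsh lnq invf_div.
have -> : ln (1 / eta ^+ 2) = 2 * ln eta^-1.
  by rewrite div1r -exprVn lnXn ?invr_gt0// mulr_natl.
by rewrite [2 * _ * (_ / _)]mulrC divfK// gt_eqF ?mulr_gt0.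
Qed.

(** Here [s = m] suffices: the rate keeps a factor [1/p], but so does [ln (1/etat^2) = 2 L / p],
    because [etat = eta^(1/p)]. The quotient [2 m + delta] is free of p. *)
Lemma ell2_prescribed eta Q C eps delta (p B2 : nat) :
  0 < eta < 1 -> 0 < delta -> (0 < p)%N ->
  let n0 := delay_periods p B2 in
  let D := p%:R * (1 + n0) * ((1 + 2 * (1 + n0) * delta^-1)
             / (expR 1 * ln eta^-1)) in
  let epst := eps / (C + D) * eta `^ ((p%:R - 1) / (p%:R * (1 + n0))) in
  exists2 q, unique (qpar (cpar eta p B2 eta) D) q &
    ell2 eta Q C eps p B2 q eta =
      Q / (eta `^ (2 + 2 / p%:R) * ln (1 / eta `^ (2 / p%:R)))
        * (1 / epst) `^ (2 * (n0 + 1) + delta)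
      + (Num.ceil (ln (1 / epst)
           * ((2 * (n0 + 1) + delta) / (2 * ln eta^-1 / p%:R))))%:~R.
Proof.
move=> eta01 d0 p_gt0 n0 D epst; have /andP[eta0 eta1] := eta01.
have p0 : 0 < p%:R :> R by rewrite ltr0n.
have m0 : 0 < 1 + n0 by rewrite ltr_pwDl ?delay_periods_ge0.
have L0 : 0 < ln eta^-1 by rewrite ln_gt0// invf_gt1.
have [|q uq lnq] := @prescribed_rate eta p%:R (1 + n0) (1 + n0) delta D eta01 p0 m0 m0 d0.
  by rewrite /D mulrA.
exists q; first by rewrite /cpar rhoE.
have DE : D = Dpar (cpar eta p B2 eta) q by case: uq => -[_]; rewrite /cpar rhoE.
have s2d : 0 < 2 * (1 + n0) + delta by rewrite addr_gt0 ?mulr_gt0.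
have {}lnq : ln (1 / q) = 2 * ln eta^-1 / p%:R / (2 * (1 + n0) + delta).
  by rewrite lnq; field; rewrite !gt_eqF.
rewrite /ell2 (scaled_epsE _ _ DE) -/n0 [n0 + 1]addrC -/epst lnq invf_div.
have -> : (eta `^ p%:R^-1) ^+ 2 = eta `^ (2 / p%:R).
  by rewrite -powR_mulrn ?powR_ge0// -powRrM mulrC.
have -> : eta `^ (2 / p%:R) * eta ^+ 2 = eta `^ (2 + 2 / p%:R).
  by rewrite powRD ?(gt_eqF eta0) ?implybT// powR_mulrn ?ltW// mulrC.
have lnE : ln (1 / eta `^ (2 / p%:R)) = 2 * ln eta^-1 / p%:R.
  by rewrite div1r -powRN ln_powR lnV//; ring.
by rewrite lnE [_ / _ * (_ / _)]mulrC divfK// gt_eqF ?divr_gt0 ?mulr_gt0.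
Qed.

End rate.

Theorem theorem4 (R : realType) (N : nat) (G : stoch_game R N)
    (M : 'I_N -> R) (mu : R) (xstar : profile G) (x0 : Omega G -> profile G)
    (C delta eps : R) (i : 'I_N)
    (hG : standing_assumptions G M)
    (hmu : 0 < mu)
    (hdom : diagonal_dominance G)
    (hxstar : nash_equilibrium xstar)
    (hC : 0 <= C)
    (hx0 : initial_error_bound xstar x0 C)
    (hdelta : 0 < delta)
    (heps : 0 < eps) :
  let a := a_infty G mu in
  let eta := a in
  let Q := Qconst G M mu i in
  let e := expR 1 : R in
  (forall (B1 B2 : nat) (U : nat -> {set 'I_N})
      (tau : 'I_N -> 'I_N -> nat -> nat),
    (1 <= B1)%N -> updates_within U B1 -> delays_within tau B2 ->
    let n0 := delay_periods B1 B2 in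
    let n' := B1%:R * (1 + n0) in
    let c := cpar a B1 B2 eta in
    [/\ let D := (n' + 2 * n' ^+ 2 * delta^-1) / (e * ln eta^-1) in
        let epsh :=
          eps / (C + D) * eta `^ ((B1%:R - 1) / (B1%:R * (n0 + 1))) in
        exists q, unique (qpar c D) q /\
          ell1 a Q C eps B1 B2 q eta <=
            Q / (eta ^+ 4 * ln (1 / eta ^+ 2))
              * (1 / epsh) `^ (2 * n' + delta)
            + (Num.ceil (ln (1 / epsh)
                 * ((2 * n' + delta) / (2 * ln eta^-1))))%:~R,
        B1 = 1%N ->
        let D := ((1 + B2%:R) + 2 * (1 + B2%:R) ^+ 2 * delta^-1)
                   / (e * ln eta^-1) in
        exists q, unique (qpar c D) q /\
          ell1 a Q C eps B1 B2 q eta <=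
            Q / (eta ^+ 4 * ln (1 / eta ^+ 2))
              * ((C + D) / eps) `^ (2 * (1 + B2%:R) + delta)
            + (Num.ceil (ln ((C + D) / eps)
                 * ((2 * (B2%:R + 1) + delta) / (2 * ln eta^-1))))%:~R
      & B1 = 1%N -> B2 = 0%N ->
        let D := (1 + 2 * delta^-1) / (e * ln eta^-1) in
        exists q, unique (qpar c D) q /\
          ell1 a Q C eps B1 B2 q eta <=
            Q / (eta ^+ 4 * ln (1 / eta ^+ 2))
              * ((C + D) / eps) `^ (2 + delta)
            + (Num.ceil (ln ((C + D) / eps)
                 * ((2 + delta) / (2 * ln eta^-1))))%:~R])
  /\
  (forall (B2 : nat) (U : nat -> {set 'I_N})
      (tau : 'I_N -> 'I_N -> nat -> nat),
    cyclic_updates U -> delays_within tau B2 ->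
    let n0 := delay_periods N B2 in
    let c := cpar a N B2 eta in
    (let D := N%:R * (1 + n0) * ((1 + 2 * (1 + n0) * delta^-1)
                / (e * ln eta^-1)) in
     let epst := eps / (C + D) * eta `^ ((N%:R - 1) / (N%:R * (1 + n0))) in
     exists q, unique (qpar c D) q /\
       ell2 a Q C eps N B2 q eta <=
         Q / (eta `^ (2 + 2 / N%:R) * ln (1 / eta `^ (2 / N%:R)))
           * (1 / epst) `^ (2 * (n0 + 1) + delta)
         + (Num.ceil (ln (1 / epst)
              * ((2 * (n0 + 1) + delta) / (2 * ln eta^-1 / N%:R))))%:~R)
    /\
    (B2 = 0%N ->
     let D := N%:R * (1 + 2 * delta^-1) / (e * ln eta^-1) in
     let epst := eps / (C + D) * eta `^ ((N%:R - 1) / N%:R) in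
     exists q, unique (qpar c D) q /\
       ell2 a Q C eps N B2 q eta <=
         Q / (eta `^ (2 + 2 / N%:R) * ln (1 / eta `^ (2 / N%:R)))
           * (1 / epst) `^ (2 + delta)
         + (Num.ceil (ln (1 / epst)
              * ((2 + delta) * N%:R / (2 * ln eta^-1))))%:~R)).
Proof.
move=> a eta Q e.
have N0 : (0 < N)%N by exact: leq_ltn_trans (leq0n i) (ltn_ord i).
have eta01 : 0 < eta < 1.
  (* The equilibrium serves as the feasible profile. *)
  by apply: a_infty_itv => //; exists xstar; case: hxstar.
split=> [B1 B2 U tau B1_gt0 _ _ | B2 U tau _ _].
  move=> n0 n' c.
  have [q uq ellE] := ell1_prescribed Q C eps B2 eta01 hdelta B1_gt0.
  split.
  - by exists q; split; [exact: uq | rewrite ellE].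
  - move=> B1E; move: uq ellE; rewrite /c B1E delay_periods1 !mul1r => uq ellE.
    exists q; split; first exact: uq.
    (* For [B1 = 1] the exponent [(B1 - 1) / (B1 (n0 + 1))] vanishes, so the power of [eta] is 1 and
       [1 / epsh] becomes [(C + D) / eps]. *)
    by rewrite ellE subrr mul0r powRr0 mulr1 invf_div [B2%:R + 1]addrC.
  - move=> B1E B2E; move: uq ellE.
    rewrite /c B1E B2E delay_periods1 !mul1r !addr0 expr1n !mulr1 => uq ellE.
    exists q; split; first exact: uq.
    by rewrite ellE subrr mul0r powRr0 mulr1 invf_div.
move=> n0 c.
have [q uq ellE] := ell2_prescribed Q C eps B2 eta01 hdelta N0.
split.
  by exists q; split; [exact: uq | rewrite ellE].
move=> B2E; move: uq ellE.
(* Without delays [n0 = 0]; what remains is to regroup the quotients in D and under the ceiling. *)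
rewrite /c B2E delay_periods0 addr0 add0r !mulr1 => uq ellE.
rewrite -mulrA; exists q; split; first exact: uq.
by rewrite ellE -[_ / (2 * _)]mulrA invf_div mulrA.
Qed.
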